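(* Let $A$ be a finite alphabet with at least two letters and let $r\geq 1$. Then for every sufficiently large dimension $n$ there is a collection $\mathscr{L}$ of combinatorial lines in $A^n$ containing neither tripods nor triangles such that for every colouring of $A^n$ with $r$ colours some line in $\mathscr{L}$ is monochromatic (i.e. the hypergraph on $A^n$ with edge set $\mathscr{L}$ has chromatic number greater than $r$).
   Context: A combinatorial line in $A^n$ is a set $L=\{\eta(a)\colon a\in A\}$ where, for some partition $[n]=C\cup M_L$ with $C\cap M_L=\emptyset$, $M_L\neq\emptyset$, and some function $g\colon C\to A$, the point $\eta(a)$ has $i$-th coordinate $g(i)$ for $i\in C$ and $a$ for $i\in M_L$; since $|A|\ge 2$ the set $M_L$ (the moving coordinates of $L$) is determined by $L$. Three distinct combinatorial lines form a triangle if any two of them intersect but they do not all pass through a common point. Three distinct combinatorial lines $L,L',L''$ passing through a common point form a tripod if $M_L$ is the disjoint union of $M_{L'}$ and $M_{L''}$. *)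

(* Defs.v *)
From mathcomp Require Import all_boot.
Set Implicit Arguments. Unset Strict Implicit. Unset Printing Implicit Defensive.

Section Lines.
Variables (A : finType) (n : nat).

Definition point := {ffun 'I_n -> A}.

Definition line_pt (M : {set 'I_n}) (g : {ffun 'I_n -> A}) (a : A) : point :=
  [ffun i => if i \in M then a else g i].

Definition is_comb_line (L : {set point}) : Prop :=
  exists (M : {set 'I_n}) (g : {ffun 'I_n -> A}),
    M != set0 /\ L = [set line_pt M g a | a : A].

(* moving coordinates of L: the coordinates that are not constant on L
   (for a combinatorial line with |A| >= 2 this is exactly M_L) *)
Definition moving (L : {set point}) : {set 'I_n} :=
  [set i | [exists x in L, exists y in L, x i != y i]].

Definition is_triangle (L1 L2 L3 : {set point}) : Prop :=
  [/\ L1 != L2, L1 != L3 & L2 != L3] /\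
  [/\ L1 :&: L2 != set0, L1 :&: L3 != set0 & L2 :&: L3 != set0] /\
  L1 :&: L2 :&: L3 = set0.

Definition is_tripod (L1 L2 L3 : {set point}) : Prop :=
  [/\ L1 != L2, L1 != L3 & L2 != L3] /\
  L1 :&: L2 :&: L3 != set0 /\
  [disjoint moving L2 & moving L3] /\
  moving L1 = moving L2 :|: moving L3.

End Lines.

(* Main.v *)
Require Import Defs.
From mathcomp Require Import all_boot.
From mathcomp Require Import zify.
Set Implicit Arguments. Unset Strict Implicit. Unset Printing Implicit Defensive.

(** A random sparsification of the Hales-Jewett theorem. Put [t = #|A|] and let
    [N] be a Hales-Jewett dimension for [r] colours (obtained by Shelah's
    argument). Cut [N * q] of the [n] coordinates into [N] blocks of size [q];
    one coordinate from each block together with values for all other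
    coordinates gives an [N]-dimensional subspace of [A^n], and a sample is such a
    subspace together with one of its lines. Every colouring makes a proportion
    of at least [1 / (2 t)^N] of all samples monochromatic.

    Draw [C * t^n] independent samples, with [C] independent of [n]. For [C] large,
    with high probability every one of the [r^(t^n)] colourings has at least [t^n]
    monochromatic samples among those drawn (exponential moment and union bound).
    On the other hand a sample passes through a given point with probability
    [O(t^-n)], and the third line of a triangle or tripod passes through one of
    boundedly many points and has a prescribed moving coordinate, which costs a
    further factor [1 / q]. So the expected number of triangles and tripods is
    [O(t^n / q)], and for [q] large fewer than [t^n] lines have to be deleted. *)

(** * The Hales-Jewett theorem *)

Section HalesJewett.
Variable A : finType.

Definition subspace_pt (n N : nat) (p : 'I_n -> A + 'I_N) (y : point A N) : point A n :=
  [ffun i => match p i with inl a => a | inr j => y j end].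

Lemma subspace_pt_line n N (p : 'I_n -> A + 'I_N) M (g : point A N) a :
  subspace_pt p (line_pt M g a) =
  line_pt [set i | if p i is inr j then j \in M else false] (subspace_pt p g) a.
Proof.
by apply/ffunP => i; rewrite !ffunE inE; case: (p i) => // j; rewrite !ffunE.
Qed.

Definition glue (n m : nat) (x : point A n) (y : point A m) : point A (n + m) :=
  [ffun i => match split i with inl j => x j | inr k => y k end].

(** Pigeonhole on the [#|C| + 1] words that are [b] before position [s] and [a] from there on: two
    of equal colour differ exactly on an interval, which becomes the moving set. *)
Lemma line_agreeing_at_two_letters (a b : A) (C : finType) :
  exists m, forall c : point A m -> C, exists (M : {set 'I_m}) (g : point A m),
    M != set0 /\ c (line_pt M g a) = c (line_pt M g b).
Proof.
exists #|C| => c.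
pose w (s : nat) : point A #|C| := [ffun i : 'I_#|C| => if i < s then b else a].
have [s [s' [lt_ss' cE]]] :
    exists s s' : 'I_#|C|.+1, s < s' /\ c (w s) = c (w s').
  have /injectivePn[s [s' ne_ss' cE]] :
      ~~ injectiveb (fun s : 'I_#|C|.+1 => c (w s)).
    apply/injectiveP => /leq_card; rewrite card_ord; lia.
  have [lt | gt | eq] := ltngtP s s'; first by exists s, s'.
    by exists s', s.
  by case/eqP: ne_ss'; apply: val_inj.
have sC : s < #|C| by have := ltn_ord s'; lia.
exists [set i : 'I_#|C| | s <= i < s'], (w s); split.
  by apply/set0Pn; exists (Ordinal sC); rewrite inE /= leqnn.
suff -> : line_pt [set i : 'I_#|C| | s <= i < s'] (w s) a = w s.
  suff -> : line_pt [set i : 'I_#|C| | s <= i < s'] (w s) b = w s' by [].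
  apply/ffunP => i; rewrite !ffunE inE.
  case: (leqP s i) => /= h; case: (ltnP i s') => // h'.
  by move: h; rewrite ltnNge (leq_trans (ltnW lt_ss') h').
apply/ffunP => i; rewrite !ffunE inE.
by case: (leqP s i) => /= h //; case: (ltnP i s').
Qed.

(* Shelah's lemma: the last block is fixed first, so that the remaining
   coordinates see it only through the finitely many colours [{ffun A -> C}]. *)
Lemma insensitive_subspace (a b : A) (N : nat) : forall C : finType,
  exists n, forall c : point A n -> C, exists p : 'I_n -> A + 'I_N,
    (forall j, exists i, p i = inr j) /\
    (forall y y' : point A N,
       (forall j, y j = y' j \/ y j = a /\ y' j = b) ->
       c (subspace_pt p y) = c (subspace_pt p y')).
Proof.
elim: N => [|N IHN] C.
  exists 0 => c; exists inr.
  split=> [[]//|y y' _]; congr (c _); apply/ffunP => -[//].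
have [n IHn] := IHN {ffun A -> C}.
(* The last block is coloured by functions on the first, so its line agrees at [a] and [b] for all
   first blocks at once. *)
have [m Hm] := line_agreeing_at_two_letters a b {ffun point A n -> C}.
exists (n + m) => c.
have [M [g [M0 Mab]]] := Hm (fun z => [ffun x => c (glue x z)]).
have [p [psurj pins]] := IHn (fun x => [ffun z => c (glue x (line_pt M g z))]).
pose p' (i : 'I_(n + m)) : A + 'I_N.+1 :=
  match split i with
  | inl i => match p i with inl x => inl x | inr j => inr (lift ord0 j) end
  | inr k => if k \in M then inr ord0 else inl (g k)
  end.
have p'E (y : point A N.+1) : subspace_pt p' y =
    glue (subspace_pt p [ffun j => y (lift ord0 j)]) (line_pt M g (y ord0)).
  apply/ffunP => i; rewrite !ffunE /p'; case: (split i) => k; rewrite ffunE.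
    by case: (p k) => // j; rewrite ffunE.
  by case: ifP.
exists p'; split.
  move=> j; case: (unliftP ord0 j) => [j'|] ->.
    have [i pi] := psurj j'; exists (lshift m i).
    by rewrite /p' (unsplitK (inl i)) pi.
  have [k kM] := set0Pn _ M0; exists (rshift n k).
  by rewrite /p' (unsplitK (inr k)) kM.
move=> y y' yy'; rewrite !p'E.
set u := [ffun j => y _]; set u' := [ffun j => y' _].
have uu' : forall j, u j = u' j \/ u j = a /\ u' j = b.
  by move=> j; rewrite !ffunE.
have /ffunP/(_ (y ord0)) := pins u u' uu'; rewrite !ffunE => ->.
case: (yy' ord0) => [-> // | [-> ->]].
by have /ffunP/(_ (subspace_pt p u')) := Mab; rewrite !ffunE.
Qed.

(** Induction on [#|B|]: in a subspace where [c] cannot tell [a] from [b], a line constant on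
    [B :\ b] is constant on [B]. *)
Lemma hales_jewett_subalphabet (x0 : A) (C : finType) (B : {set A}) :
  exists N, forall c : point A N -> C, exists (M : {set 'I_N}) (g : point A N),
    M != set0 /\ {in B &, forall a b, c (line_pt M g a) = c (line_pt M g b)}.
Proof.
elim: {B}_.+1 {-2}B (ltnSn #|B|) => // k IHk B leBk.
have [B1 | B1] := boolP (#|B| <= 1).
  (* Dimension 1 rather than 0, since the moving set must be nonempty. *)
  exists 1 => c; exists setT, [ffun=> x0]; split.
    by apply/set0Pn; exists ord0; rewrite inE.
  by move=> a b aB bB; rewrite (card_le1_eqP B1 a b).
have /card_gt1P[a [b [aB bB ne_ab]]] : 1 < #|B| by rewrite ltnNge.
have [|N HN] := IHk (B :\ b).
  by have := cardsD1 b B; rewrite bB; lia.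
have [n Hn] := insensitive_subspace a b N C.
exists n => c; have [p [psurj pins]] := Hn c.
have [M [g [M0 mono]]] := HN (fun y => c (subspace_pt p y)).
have eq_ab : c (subspace_pt p (line_pt M g a)) = c (subspace_pt p (line_pt M g b)).
  by apply: pins => j; rewrite !ffunE; case: ifP; [right | left].
exists [set i | if p i is inr j then j \in M else false], (subspace_pt p g); split.
  have [j jM] := set0Pn _ M0; have [i pi] := psurj j.
  by apply/set0Pn; exists i; rewrite inE pi.
have to_a x : x \in B -> c (subspace_pt p (line_pt M g x)) = c (subspace_pt p (line_pt M g a)).
  move=> xB; have [->|ne] := eqVneq x b; first by rewrite eq_ab.
  by apply: mono; rewrite !inE ?ne ?ne_ab.
by move=> x y xB yB; rewrite -!subspace_pt_line !to_a.
Qed.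

Lemma hales_jewett (x0 : A) (C : finType) :
  exists N, forall c : point A N -> C, exists (M : {set 'I_N}) (g : point A N),
    M != set0 /\ forall a b, c (line_pt M g a) = c (line_pt M g b).
Proof.
have [N HN] := hales_jewett_subalphabet x0 C setT; exists N => c.
have [M [g [M0 H]]] := HN c; exists M, g; split=> // a b.
by apply: H; rewrite inE.
Qed.

End HalesJewett.

(** * Sampling with few conflicts *)

Lemma leq_card_in_imset (T U : finType) (h : T -> U) (X : {set T}) (Y : {set U}) :
  {in X &, injective h} -> {in X, forall x, h x \in Y} -> #|X| <= #|Y|.
Proof.
move=> inj sub; rewrite -(card_in_imset inj); apply/subset_leq_card/subsetP.
by move=> _ /imsetP[x xX ->]; apply: sub.
Qed.

Lemma leq_bernoulli m k : m ^ k * (m + k) <= m * m.+1 ^ k.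
Proof.
elim: k => [|k IHk]; first by rewrite !expn0; lia.
rewrite !expnS; set x := m ^ k in IHk *; set y := m.+1 ^ k in IHk *.
apply: (@leq_trans (m.+1 * (x * (m + k)))); nia.
Qed.

(** Bernoulli with exponent [8 * r * m]: the factor [1 + k / m] exceeds [8 * r]. This dictates [C]
    in [sparse_sample]. *)
Lemma leq_exp_ratio r m : 0 < m -> m ^ (8 * r * m) * (8 * r) <= m.+1 ^ (8 * r * m).
Proof.
move=> m0; have := leq_bernoulli m (8 * r * m).
set x := m ^ _; set y := m.+1 ^ _ => H.
rewrite -(leq_pmul2l m0); apply: leq_trans H; nia.
Qed.

Section SparseSample.
Variable W : finType.

(** Values at three distinct indices are independent and uniform: swapping them for an arbitrary
    triple is injective. *)
Lemma card_ffun_triple K (i1 i2 i3 : 'I_K) (T : {set W * W * W}) :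
  i1 != i2 -> i1 != i3 -> i2 != i3 ->
  #|[set f : {ffun 'I_K -> W} | (f i1, f i2, f i3) \in T]| * #|W| ^ 3
    <= #|T| * #|W| ^ K.
Proof.
move=> n12 n13 n23; set F := [set f | _].
pose h (z : {ffun 'I_K -> W} * (W * W * W)) : (W * W * W) * {ffun 'I_K -> W} :=
  let: (f, (a, b, c)) := z in
  ((f i1, f i2, f i3),
   [ffun i => if i == i1 then a else if i == i2 then b else if i == i3 then c else f i]).
have := @leq_card_in_imset _ _ h (setX F setT) (setX T setT).
rewrite !cardsX !cardsT !card_prod card_ffun card_ord.
have -> : #|W| ^ 3 = #|W| * #|W| * #|W| by rewrite !expnS expn0 muln1 mulnA.
apply.
  move=> [f [[a b] c]] [f' [[a' b'] c']] _ _ /= [e1 e2 e3 /ffunP E].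
  have Ea : a = a' by have := E i1; rewrite !ffunE eqxx.
  have Eb : b = b'.
    by have := E i2; rewrite !ffunE eqxx (eq_sym i2) (negPf n12).
  have Ec : c = c'.
    have := E i3; rewrite !ffunE eqxx (eq_sym i3) (negPf n13).
    by rewrite (eq_sym i3) (negPf n23).
  suff -> : f = f' by rewrite Ea Eb Ec.
  apply/ffunP => i; have := E i; rewrite !ffunE.
  have [->//|_] := eqVneq i i1; have [->//|_] := eqVneq i i2.
  by have [->|_] := eqVneq i i3.
by move=> [f [[a b] c]]; rewrite !inE /= !andbT.
Qed.

(* Exponential moment: weight [1] on [D] and [2] off [D]. *)
Lemma card_ffun_few_hits K V (D : {set W}) :
  #|[set f : {ffun 'I_K -> W} | #|[set i | f i \in D]| < V]| * 2 ^ K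
    <= 2 ^ V * (2 * #|W| - #|D|) ^ K.
Proof.
pose w x := if x \in D then 1 else 2.
have sumw : \sum_x w x = 2 * #|W| - #|D|.
  have -> : \sum_x w x = \sum_(x in D) 1 + \sum_(x | x \notin D) 2.
    rewrite (bigID (mem D)) /=; congr (_ + _); apply: eq_bigr => x.
      by rewrite /w => ->.
    by rewrite /w => /negPf->.
  have -> : \sum_(x | x \notin D) 2 = \sum_(x in ~: D) 2.
    by apply: eq_bigl => x; rewrite inE.
  by rewrite !sum_nat_const -(cardsC D) muln1; lia.
have prodw (f : {ffun 'I_K -> W}) :
    \prod_i w (f i) * 2 ^ #|[set i | f i \in D]| = 2 ^ K.
  have -> : \prod_i w (f i) = 2 ^ #|~: [set i | f i \in D]|.
    rewrite (bigID (fun i => f i \in D)) /= big1 ?mul1n => [|i]; last by rewrite /w => ->.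
    rewrite (eq_bigr (fun=> 2)) => [|i /negPf]; last by rewrite /w => ->.
    by rewrite prod_nat_const; congr (_ ^ _); apply: eq_card => i; rewrite !inE.
  by rewrite -expnD addnC cardsC card_ord.
have <- : \sum_(f : {ffun 'I_K -> W}) \prod_i w (f i) = (2 * #|W| - #|D|) ^ K.
  by rewrite -(bigA_distr_bigA (fun _ x => w x)) prod_nat_const card_ord sumw.
(* Markov: fewer than [V] hits force weight at least [2 ^ (K - V)]. *)
rewrite -sum_nat_const big_distrr /= big_mkcond /=.
apply: leq_sum => f _; case: ifP => //; rewrite inE => lt_V.
by rewrite -(prodw f) mulnC leq_mul2r leq_exp2l // (ltnW lt_V) orbT.
Qed.

(** Deletion method with [K = C * V] draws. The bound on [T] makes the expected number of bad
    triples at most [V / 2]. Some [f] has fewer than [V] of them while every [c] is hit at least [V]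
    times; dropping the first index of each bad triple leaves every [c] a hit. *)
Lemma sparse_sample (Col : finType) (T : {set W * W * W}) (mono : Col -> {set W})
    (r lam V : nat) (C := 8 * r * (2 * lam).-1) :
  0 < V -> 0 < lam -> 0 < #|W| -> #|Col| <= r ^ V ->
  (forall c, #|W| <= lam * #|mono c|) ->
  2 * #|T| * C ^ 3 * V ^ 2 <= #|W| ^ 3 ->
  exists K (f : {ffun 'I_K -> W}) (S : {set 'I_K}),
    (forall c, exists2 i, i \in S & f i \in mono c) /\
    (forall i1 i2 i3, i1 \in S -> i1 != i2 -> i1 != i3 -> i2 != i3 ->
       (f i1, f i2, f i3) \notin T).
Proof.
move=> V0 lam0 W0 leCol leMono leT; pose K := C * V; exists K.
pose bad (f : {ffun 'I_K -> W}) (z : 'I_K * 'I_K * 'I_K) :=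
  [&& z.1.1 != z.1.2, z.1.1 != z.2, z.1.2 != z.2 & (f z.1.1, f z.1.2, f z.2) \in T].
pose nbad f := #|[set z | bad f z]|.
pose F1 := [set f | V <= nbad f].
pose F2 := \bigcup_(c : Col) [set f : {ffun 'I_K -> W} | #|[set i | f i \in mono c]| < V].
have F1le : 2 * #|F1| <= #|W| ^ K.
  have sumle : (\sum_f nbad f) * #|W| ^ 3 <= K ^ 3 * (#|T| * #|W| ^ K).
    have -> : \sum_f nbad f = \sum_z #|[set f | bad f z]|.
      rewrite /nbad; under eq_bigr => f _ do rewrite -sum1_card big_mkcond /=.
      rewrite exchange_big /=; apply: eq_bigr => z _.
      by rewrite -sum1_card [RHS]big_mkcond /=; apply: eq_bigr => f _; rewrite !inE.
    rewrite big_distrl /=.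
    have -> : K ^ 3 = #|{: 'I_K * 'I_K * 'I_K}|.
      by rewrite !card_prod card_ord !expnS expn0 muln1 mulnA.
    rewrite -sum_nat_const; apply: leq_sum => -[[i1 i2] i3] _ /=.
    have [/and3P[n12 n13 n23]|/negPf nz] :=
        boolP [&& i1 != i2, i1 != i3 & i2 != i3].
      apply: leq_trans (card_ffun_triple T n12 n13 n23).
      rewrite leq_mul2r; apply/orP; right; apply/subset_leq_card/subsetP => f.
      by rewrite !inE /bad /= => /and4P[].
    rewrite (_ : [set f | _] = set0) ?cards0 ?mul0n //.
    apply/setP => f; rewrite !inE /bad /=; apply/negP => /and4P[h1 h2 h3 _].
    by rewrite h1 h2 h3 in nz.
  have markov : #|F1| * V <= \sum_f nbad f.
    rewrite -sum_nat_const big_mkcond /=; apply: leq_sum => f _.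
    by rewrite inE; case: ifP.
  have W3 : 0 < #|W| ^ 3 * V by rewrite muln_gt0 expn_gt0 W0.
  rewrite -(leq_pmul2l W3).
  have {}markov := leq_mul markov (leqnn (#|W| ^ 3)).
  have {markov}sumle := leq_trans markov sumle.
  have {}leT := leq_mul leT (leqnn (V * #|W| ^ K)).
  apply: (@leq_trans (2 * (K ^ 3 * (#|T| * #|W| ^ K)))).
    by move: sumle; set x := #|F1|; set y := #|W| ^ 3; lia.
  apply: (@leq_trans (2 * #|T| * C ^ 3 * V ^ 2 * (V * #|W| ^ K))); last by rewrite -[X in _ <= X]mulnA.
  rewrite /K expnMn (expnSr V 2).
  by apply: eq_leq; move: (C ^ 3) (V ^ 2) (#|W| ^ _) #|T| => a b c d; lia.
have F2le : 4 * #|F2| <= #|W| ^ K.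
  have m0 : 0 < (2 * lam).-1 by lia.
  (* Density at least [1 / lam] turns the moment bound into [2 ^ V * (1 - 1 / (2 * lam)) ^ K]. *)
  have step c : #|[set f : {ffun 'I_K -> W} | #|[set i | f i \in mono c]| < V]|
      * (2 * lam) ^ K <= 2 ^ V * (2 * lam).-1 ^ K * #|W| ^ K.
    have := card_ffun_few_hits K V (mono c).
    set x := #|_|; set Y := 2 * _ - _ => hits.
    have leY : lam ^ K * Y ^ K <= (2 * lam).-1 ^ K * #|W| ^ K.
      rewrite -!expnMn; have [->|K0] := posnP K; first by rewrite !expn0.
      by rewrite leq_exp2r // /Y; have := leMono c; nia.
    rewrite expnMn mulnA.
    apply: leq_trans (leq_mul hits (leqnn (lam ^ K))) _.
    by rewrite -!mulnA leq_mul2l [Y ^ K * _]mulnC leY orbT.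
  have leF2 : #|F2| * (2 * lam) ^ K <= r ^ V * (2 ^ V * (2 * lam).-1 ^ K * #|W| ^ K).
    apply: (@leq_trans (#|Col| * (2 ^ V * (2 * lam).-1 ^ K * #|W| ^ K))); last first.
      by rewrite leq_mul2r leCol orbT.
    apply: (@leq_trans ((\sum_(c : Col) #|[set f : {ffun 'I_K -> W} |
                           #|[set i | f i \in mono c]| < V]|) * (2 * lam) ^ K)).
      rewrite leq_mul2r; apply/orP; right; rewrite /F2.
      elim/big_rec2: _ => [|c y X _ le_y]; first by rewrite cards0.
      by apply: leq_trans (leq_card_setU _ _) _; rewrite leq_add2l.
    by rewrite big_distrl /= -sum_nat_const; apply: leq_sum => c _.
  (* In [8 * r], a factor 2 pays for the exponential moment, [r] for the union over [Col], and the
     remaining 4 gives the quarter. *)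
  have ratio : (2 * lam).-1 ^ K * (8 * r) ^ V <= (2 * lam) ^ K.
    rewrite /K !(expnM _ C V) -expnMn leq_exp2r //.
    have predK : (2 * lam).-1.+1 = 2 * lam by lia.
    by have := leq_exp_ratio r m0; rewrite -/C predK.
  have L0 : 0 < (2 * lam) ^ K by rewrite expn_gt0; lia.
  apply: (@leq_trans (4 ^ V * #|F2|)).
    by rewrite leq_mul2r -{1}(expn1 4) leq_exp2l // V0 orbT.
  rewrite -(leq_pmul2r L0) -mulnA.
  apply: leq_trans (leq_mul (leqnn _) leF2) _.
  rewrite [X in _ <= X]mulnC.
  apply: leq_trans (leq_mul ratio (leqnn _)).
  have -> : 8 * r = 4 * (r * 2) by lia.
  by rewrite (expnMn 4) (expnMn r); apply: eq_leq; rewrite !mulnA; lia.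
have [f] : exists f, f \notin F1 :|: F2.
  apply/existsP; rewrite -negb_forall; apply/negP => /forallP all12.
  have : #|{ffun 'I_K -> W}| <= #|F1| + #|F2|.
    rewrite -cardsT; apply: leq_trans (leq_card_setU F1 F2).
    by apply/subset_leq_card/subsetP => f _.
  rewrite card_ffun card_ord.
  have : 0 < #|W| ^ K by rewrite expn_gt0 W0.
  lia.
rewrite !inE negb_or -ltnNge => /andP[nF1 nF2].
exists f, [set i | [forall z, bad f z ==> (z.1.1 != i)]]; split.
  move=> c.
  have : V <= #|[set i | f i \in mono c]|.
    rewrite leqNgt; apply/negP => lt; case/negP: nF2.
    by apply/bigcupP; exists c; rewrite ?inE.
  move=> leV.
  have : ~~ ([set i | f i \in mono c] \subset [set z.1.1 | z in [set z | bad f z]]).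
    apply/negP => /subset_leq_card; apply/negP; rewrite -ltnNge.
    by apply: leq_ltn_trans (leq_imset_card _ _) _; apply: leq_trans nF1 _.
  case/subsetPn => i; rewrite inE => fi ni; exists i => //.
  rewrite inE; apply/forallP => z; apply/implyP => bz; apply: contra ni => /eqP <-.
  by apply/imsetP; exists z => //; rewrite inE.
move=> i1 i2 i3; rewrite inE => /forallP/(_ (i1, i2, i3)) /= H n12 n13 n23.
apply/negP => hT; move: H; rewrite eqxx implybF => /negP; apply.
by rewrite /bad /= n12 n13 n23.
Qed.

End SparseSample.

(** * Random lines in random subspaces *)

Lemma leq_card_exists (X Y : finType) (S : {set X}) (P : X -> pred Y) (k b : nat) :
  {in S, forall x, #|[set y | P x y]| * k <= b} ->
  #|[set y | [exists x in S, P x y]]| * k <= #|S| * b.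
Proof.
move=> leb; apply: (@leq_trans ((\sum_(x in S) #|[set y | P x y]|) * k)).
  rewrite leq_mul2r; apply/orP; right.
  have -> : [set y | [exists x in S, P x y]] = \bigcup_(x in S) [set y | P x y].
    apply/setP => y; rewrite inE; apply/exists_inP/bigcupP => -[x xS].
      by exists x; rewrite ?inE.
    by rewrite inE; exists x.
  elim/big_rec2: _ => [|x m Z _ le_m]; first by rewrite cards0.
  by apply: leq_trans (leq_card_setU _ _) _; rewrite leq_add2l.
by rewrite big_distrl /= -sum_nat_const; apply: leq_sum.
Qed.

Lemma leq_card_dep_pairs (X Y : finType) (P : pred X) (Q : X -> pred Y) (k l a b : nat) :
  #|[set x | P x]| * l <= a ->
  (forall x, P x -> #|[set y | Q x y]| * k <= b) ->
  #|[set z : X * Y | P z.1 && Q z.1 z.2]| * (l * k) <= a * b.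
Proof.
move=> lea leb; apply: leq_trans (leq_mul lea (leqnn b)).
have -> : #|[set z : X * Y | P z.1 && Q z.1 z.2]| =
          \sum_(x | P x) #|[set y | Q x y]|.
  under eq_bigr => x _ do rewrite -sum1_card.
  rewrite pair_big_dep /= -sum1_card; apply: eq_bigl => -[x y].
  by rewrite !inE.
rewrite [l * k]mulnC mulnA [X in _ <= X]mulnAC leq_mul2r; apply/orP; right.
rewrite big_distrl /= -sum1_card big_distrl /=.
rewrite [X in _ <= X](eq_bigl P) => [|x]; last by rewrite inE.
by apply: leq_sum => x Px; rewrite mul1n leb.
Qed.

Section SampleSpace.
Variables (A : finType) (N q n : nat) (pos : 'I_N -> 'I_q -> 'I_n).
Hypothesis pos_inj : forall j k j' k', pos j k = pos j' k' -> j = j' /\ k = k'.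

(** Block [j] has one active coordinate, [pos j (e j)]. Values of [g] there are ignored, which keeps
    the sample space a full product. *)
Definition cube_map (e : {ffun 'I_N -> 'I_q}) (g : point A n) (i : 'I_n) : A + 'I_N :=
  if [pick j | pos j (e j) == i] is Some j then inr j else inl (g i).

(* The pair of [{ffun 'I_N -> 'I_q}] and [point A n] is a subspace of dimension
   [N] (see [cube_map]); the other two components are a line inside it.
   An empty set of moving coordinates is allowed here and excluded later. *)
Definition sample : finType :=
  ({set 'I_N} * point A N * ({ffun 'I_N -> 'I_q} * point A n))%type.

Definition sample_line (w : sample) : {set point A n} :=
  [set subspace_pt (cube_map w.2.1 w.2.2) (line_pt w.1.1 w.1.2 a) | a : A].

Lemma cube_map_pos (e : {ffun 'I_N -> 'I_q}) g j : cube_map e g (pos j (e j)) = inr j.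
Proof.
rewrite /cube_map; case: pickP => [j' /eqP/pos_inj[-> _] //|/(_ j)].
by rewrite eqxx.
Qed.

Lemma cube_map_off (e : {ffun 'I_N -> 'I_q}) g i : (forall j, pos j (e j) != i) -> cube_map e g i = inl (g i).
Proof. by move=> ni; rewrite /cube_map; case: pickP => // j; rewrite (negPf (ni j)). Qed.

Lemma sample_line_comb w : w.1.1 != set0 -> is_comb_line (sample_line w).
Proof.
case: w => -[M y] [e g] /= /set0Pn[j jM].
exists [set i | if cube_map e g i is inr j then j \in M else false].
exists (subspace_pt (cube_map e g) y); split.
  by apply/set0Pn; exists (pos j (e j)); rewrite inE cube_map_pos.
by apply: eq_imset => a; rewrite subspace_pt_line.
Qed.

Lemma card_sample_line w : #|sample_line w| <= #|A|.
Proof. exact: leq_imset_card. Qed.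

Lemma sample_line_off w x i :
  x \in sample_line w -> (forall j, pos j (w.2.1 j) != i) -> x i = w.2.2 i.
Proof. by case/imsetP => a _ -> ni; rewrite ffunE cube_map_off. Qed.

Lemma sample_line_diff w x y i :
  x \in sample_line w -> y \in sample_line w -> x i != y i ->
  exists j, i = pos j (w.2.1 j).
Proof.
move=> xw yw; case: (pickP (fun j => pos j (w.2.1 j) == i)) => [j /eqP <-|ni].
  by exists j.
have {}ni j : pos j (w.2.1 j) != i by rewrite ni.
by rewrite (sample_line_off xw ni) (sample_line_off yw ni) eqxx.
Qed.

Lemma moving_sample_neq0 w : 1 < #|A| -> w.1.1 != set0 -> moving (sample_line w) != set0.
Proof.
case: w => -[M y] [e g] /= /card_gt1P[a [b [_ _ ab]]] /set0Pn[j jM].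
apply/set0Pn; exists (pos j (e j)); rewrite inE.
pose pt c := subspace_pt (cube_map e g) (line_pt M y c).
apply/exists_inP; exists (pt a); first exact: imset_f.
apply/exists_inP; exists (pt b); first exact: imset_f.
by rewrite !ffunE cube_map_pos !ffunE jM.
Qed.

(* A point on the line determines the base point [g] off the [N] positions of
   the subspace, so only [g] on these positions is free. *)
Lemma card_samples_through x :
  #|[set w | x \in sample_line w]| * #|A| ^ n <= #|A| ^ N * #|sample|.
Proof.
pose h (z : sample * point A n) : point A N * sample :=
  ([ffun j => z.1.2.2 (pos j (z.1.2.1 j))], (z.1.1, (z.1.2.1, z.2))).
have := @leq_card_in_imset _ _ h (setX [set w | x \in sample_line w] setT) setT.
rewrite cardsX !cardsT card_prod !card_ffun !card_ord; apply=> //.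
move=> [[l [e g]] u] [[l' [e' g']] u']; rewrite !inE /= !andbT => xw xw'.
case=> /ffunP Eg El Ee Eu; subst l' e' u'.
suff -> : g = g' by [].
apply/ffunP => i; case: (pickP (fun j => pos j (e j) == i)) => [j /eqP <-|ni].
  by have := Eg j; rewrite !ffunE.
have {}ni j : pos j (e j) != i by rewrite ni.
by rewrite -(sample_line_off xw ni) -(sample_line_off xw' ni).
Qed.

(* Compared with [card_samples_through], one value of [e] is forced too, which
   gains the factor [q]. *)
Lemma card_samples_through_moving x i :
  #|[set w | (x \in sample_line w) && [exists j, i == pos j (w.2.1 j)]]| * (q * #|A| ^ n)
    <= #|A| ^ N * #|sample|.
Proof.
set F := [set w | _].
case: (pickP (fun jk : 'I_N * 'I_q => pos jk.1 jk.2 == i)) => [[j0 k0] /= /eqP def_i|ni].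
  pose upd (e : {ffun 'I_N -> 'I_q}) k : {ffun 'I_N -> 'I_q} :=
    [ffun j => if j == j0 then k else e j].
  pose h (z : sample * ('I_q * point A n)) : point A N * sample :=
    ([ffun j => z.1.2.2 (pos j (z.1.2.1 j))], (z.1.1, (upd z.1.2.1 z.2.1, z.2.2))).
  have := @leq_card_in_imset _ _ h (setX F setT) setT.
  rewrite cardsX !cardsT !card_prod !card_ffun !card_ord; apply=> //.
  move=> [[l [e g]] [k u]] [[l' [e' g']] [k' u']]; rewrite !inE /= !andbT.
  move=> /andP[xw /existsP[j /eqP Ej]] /andP[xw' /existsP[j' /eqP Ej']].
  move: Ej Ej'; rewrite -def_i => /pos_inj[Ej Ek] /pos_inj[Ej' Ek']; subst j j'.
  case=> /ffunP Eg El /ffunP Ee Eu; subst l' u'.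
  have Ekk : k = k' by have := Ee j0; rewrite !ffunE eqxx.
  have Eee : e = e'.
    apply/ffunP => j; have := Ee j; rewrite !ffunE.
    by have [->|//] := eqVneq j j0; rewrite -Ek -Ek'.
  subst k' e'.
  suff -> : g = g' by [].
  apply/ffunP => i'; case: (pickP (fun j => pos j (e j) == i')) => [j /eqP <-|ni].
    by have := Eg j; rewrite !ffunE.
  have {}ni j : pos j (e j) != i' by rewrite ni.
  by rewrite -(sample_line_off xw ni) -(sample_line_off xw' ni).
rewrite (_ : F = set0) ?cards0 //; apply/setP => w; rewrite !inE.
apply/negP => /andP[_ /existsP[j /eqP ij]].
by have := ni (j, w.2.1 j); rewrite /= -ij eqxx.
Qed.

(** * Counting triangles and tripods *)

Definition meeting (w : sample * sample) : bool :=
  [exists x in sample_line w.1, x \in sample_line w.2].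

Definition closes_triangle (w : sample * sample) (u : sample) : bool :=
  [exists x in sample_line w.1, exists y in sample_line w.2,
    [&& x != y, x \in sample_line u & y \in sample_line u]].

(** A necessary condition for a tripod in which [u] has the larger moving set and [w.1] is one of
    the two smaller lines. An empty moving set would prescribe no coordinate, hence the first
    clause. *)
Definition closes_tripod (w : sample * sample) (u : sample) : bool :=
  (moving (sample_line w.1) != set0) &&
  [exists x in sample_line w.1,
    (x \in sample_line u) && (moving (sample_line w.1) \subset moving (sample_line u))].

Definition conflicts : {set sample * sample * sample} :=
  [set z | meeting z.1 && (closes_triangle z.1 z.2 || closes_tripod z.1 z.2)].

Let E := #|A| ^ N * #|sample|.

(** There are at most [#|A| ^ 2] pairs [x], [y], and a coordinate where they differ must be active
    in [u]. *)
Lemma card_closes_triangle w :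
  #|[set u | closes_triangle w u]| * (q * #|A| ^ n) <= #|A| * (#|A| * E).
Proof.
apply: leq_trans (leq_mul (card_sample_line w.1) (leqnn _)).
apply: leq_card_exists => x _.
apply: leq_trans (leq_mul (card_sample_line w.2) (leqnn _)).
apply: leq_card_exists => y _.
have [->|] := eqVneq x y.
  by rewrite eq_card0 // => u; rewrite !inE ?eqxx.
move=> ne_xy.
have [i ne_i] : exists i, x i != y i.
  apply/existsP; rewrite -negb_forall; apply: contra ne_xy => /forallP eq_xy.
  by apply/eqP/ffunP => i; apply/eqP.
apply: leq_trans (card_samples_through_moving x i).
rewrite leq_mul2r; apply/orP; right; apply/subset_leq_card/subsetP => u.
rewrite !inE => /= /andP[xu yu]; rewrite xu /=; apply/existsP.
by have [j ->] := sample_line_diff xu yu ne_i; exists j.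
Qed.

Lemma card_closes_tripod w :
  #|[set u | closes_tripod w u]| * (q * #|A| ^ n) <= #|A| * E.
Proof.
have [M0|M0] := eqVneq (moving (sample_line w.1)) set0.
  by rewrite eq_card0 // => u; rewrite !inE /closes_tripod M0 eqxx.
have [i iM] := set0Pn _ M0.
apply: leq_trans (leq_mul (card_sample_line w.1) (leqnn _)).
have -> : [set u | closes_tripod w u] = [set u | [exists x in sample_line w.1,
    (x \in sample_line u) && (moving (sample_line w.1) \subset moving (sample_line u))]].
  by apply/setP => u; rewrite !inE /closes_tripod M0.
apply: leq_card_exists => x _.
apply: leq_trans (card_samples_through_moving x i).
rewrite leq_mul2r; apply/orP; right; apply/subset_leq_card/subsetP => u.
rewrite !inE => /= /andP[-> /subsetP/(_ _ iM)]; rewrite inE /=.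
case/exists_inP => y yu /exists_inP[z zu ne_yz]; apply/existsP.
by have [j ->] := sample_line_diff yu zu ne_yz; exists j.
Qed.

(** Meeting costs a factor [#|A| ^ n] and closing costs [q * #|A| ^ n]; the choices of points and
    the values of [g] at active positions give the constant. *)
Lemma card_conflicts : 0 < #|A| ->
  #|conflicts| * q * (#|A| ^ n) ^ 2 <= 2 * #|A| ^ (3 + 2 * N) * #|sample| ^ 3.
Proof.
move=> A0.
have leU w : #|[set u | closes_triangle w u || closes_tripod w u]| * (q * #|A| ^ n)
    <= #|A| * (#|A| * E) + #|A| * E.
  apply: leq_trans (leq_add (card_closes_triangle w) (card_closes_tripod w)).
  rewrite -mulnDl leq_mul2r; apply/orP; right.
  apply: leq_trans (leq_card_setU _ _).
  by apply/subset_leq_card/subsetP => u; rewrite !inE.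
have leM : #|[set w | meeting w]| * #|A| ^ n <= #|sample| * (#|A| * E).
  have := @leq_card_dep_pairs _ _ (fun _ : sample => true)
    (fun w u => meeting (w, u)) (#|A| ^ n) 1 #|sample| (#|A| * E).
  rewrite mul1n => H; apply: leq_trans (H _ _).
  - rewrite leq_mul2r; apply/orP; right; apply/subset_leq_card/subsetP.
    by move=> [w u]; rewrite !inE.
  - by rewrite muln1 max_card.
  move=> w _; apply: leq_trans (leq_mul (card_sample_line w) (leqnn _)).
  by apply: leq_card_exists => x _; apply: card_samples_through.
have := leq_card_dep_pairs leM (fun w _ => leU w).
rewrite -/conflicts => H.
rewrite (_ : #|conflicts| * q * (#|A| ^ n) ^ 2 =
             #|conflicts| * (#|A| ^ n * (q * #|A| ^ n))); last by rewrite expnS expn1; lia.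
apply: leq_trans H _.
have -> : 2 * #|A| ^ (3 + 2 * N) * #|sample| ^ 3 =
          #|sample| * (#|A| * E) * (2 * (#|A| * (#|A| * E))).
  have -> : 3 + 2 * N = 3 + (N + N) by lia.
  rewrite /E !expnD !expnS expn0.
  by move: (#|A| ^ N) #|sample| #|A| => a b c; lia.
rewrite leq_mul2l; apply/orP; right; rewrite mul2n -addnn leq_add2l.
by rewrite leq_mul2l leq_pmull // orbT.
Qed.

Definition mono_samples (C : finType) (c : point A n -> C) : {set sample} :=
  [set w | (w.1.1 != set0) &&
    [forall x in sample_line w, forall y in sample_line w, c x == c y]].

(** Each of the subspaces [(e, g)] contains a monochromatic line among its [2 ^ N * #|A| ^ N]
    candidates. *)
Lemma card_mono_samples (C : finType) (c : point A n -> C) :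
  (forall d : point A N -> C, exists (M : {set 'I_N}) (y : point A N),
     M != set0 /\ forall a b, d (line_pt M y a) = d (line_pt M y b)) ->
  #|sample| <= 2 ^ N * #|A| ^ N * #|mono_samples c|.
Proof.
move=> HJ; rewrite /sample !card_prod leq_mul //.
  by rewrite card_ffun card_ord -cardsT -powersetT card_powerset cardsT card_ord.
rewrite -card_prod -cardsT.
apply: leq_trans (leq_imset_card (fun w : sample => w.2) _).
apply/subset_leq_card/subsetP => -[e g] _.
have [M [y [M0 H]]] := HJ (fun z => c (subspace_pt (cube_map e g) z)).
apply/imsetP; exists ((M, y), (e, g)) => //.
rewrite inE M0 /=; apply/forall_inP => _ /imsetP[a _ ->].
by apply/forall_inP => _ /imsetP[b _ ->]; apply/eqP/H.
Qed.

End SampleSpace.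

(** * Choice of parameters and the final collection *)

Theorem theorem3p7 (A : finType) (r : nat) :
  1 < #|A| -> 1 <= r ->
  exists N : nat, forall n : nat, N <= n ->
    exists Lc : {set {set point A n}},
      (forall L, L \in Lc -> is_comb_line L) /\
      (forall L1 L2 L3, L1 \in Lc -> L2 \in Lc -> L3 \in Lc ->
         ~ is_triangle L1 L2 L3 /\ ~ is_tripod L1 L2 L3) /\
      (forall c : {ffun point A n -> 'I_r},
         exists2 L, L \in Lc & exists k : 'I_r, forall x, x \in L -> c x = k).
Proof.
move=> A1 r1; have A0 : 0 < #|A| by lia.
have [x0 _] := card_gt0P A0.
have [N HJ] := hales_jewett x0 'I_r.
pose lam := 2 ^ N * #|A| ^ N.
have lam0 : 0 < lam by rewrite muln_gt0 !expn_gt0 A0.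
pose C := 8 * r * (2 * lam).-1.
have C0 : 0 < C by rewrite /C !muln_gt0; lia.
(* Chosen so that [card_conflicts] becomes exactly the bound on [T] in [sparse_sample]. *)
pose q := 4 * C ^ 3 * #|A| ^ (3 + 2 * N).
have q0 : 0 < q.
  have C3 : 0 < C ^ 3 by rewrite expn_gt0 C0.
  have t3 : 0 < #|A| ^ (3 + 2 * N) by rewrite expn_gt0 A0.
  by rewrite muln_gt0 t3 andbT muln_gt0.
exists (N * q) => n le_n.
have pos_lt (j : 'I_N) (k : 'I_q) : j * q + k < n.
  by apply: leq_trans le_n; have := ltn_ord j; have := ltn_ord k; nia.
pose pos j k : 'I_n := Ordinal (pos_lt j k).
have pos_inj j k j' k' : pos j k = pos j' k' -> j = j' /\ k = k'.
  move=> /(congr1 val) /= E.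
  have Ej : nat_of_ord j = j'.
    by have := congr1 (divn^~ q) E; rewrite /= !divnMDl // !divn_small // !addn0.
  split; apply: val_inj => //=.
  by move: E; rewrite Ej => /addnI.
pose W := sample A N q n; pose line (w : W) := sample_line pos w.
have V0 : 0 < #|A| ^ n by rewrite expn_gt0 A0.
have W0 : 0 < #|W|.
  by rewrite !card_prod !card_ffun !card_ord -cardsT -powersetT card_powerset
             !muln_gt0 !expn_gt0 A0 q0.
have leCol : #|{: {ffun point A n -> 'I_r}}| <= r ^ (#|A| ^ n).
  by rewrite !card_ffun !card_ord.
have leT : 2 * #|conflicts A pos| * C ^ 3 * (#|A| ^ n) ^ 2 <= #|W| ^ 3.
  have t0 : 0 < 2 * #|A| ^ (3 + 2 * N) by rewrite muln_gt0 expn_gt0 A0.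
  rewrite -(leq_pmul2l t0); apply: leq_trans (card_conflicts pos_inj A0).
  apply: eq_leq; rewrite /q.
  by move: (C ^ 3) (#|A| ^ _) (#|A| ^ n) #|_| => a b c d; lia.
have [K [f [S [hitS freeS]]]] := sparse_sample V0 lam0 W0 leCol
  (fun c : {ffun point A n -> 'I_r} => card_mono_samples pos c HJ) leT.
(* Samples with empty moving set are not lines and are discarded; [mono_samples] excludes them, so
   no hit is lost. *)
exists [set line (f i) | i in [set i in S | (f i).1.1 != set0]]; split; last split.
- by move=> L /imsetP[i]; rewrite inE => /andP[_ fi] ->; apply: sample_line_comb.
- move=> L1 L2 L3 /imsetP[i1 + ->] /imsetP[i2 + ->] /imsetP[i3 + ->].
  rewrite !inE => /andP[S1 M1] /andP[S2 M2] /andP[S3 M3].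
  (* Distinct lines have distinct indices. The first line goes last, as the closing one: in a tripod
     it has the larger moving set. *)
  have no_conflict : [/\ line (f i1) != line (f i2), line (f i1) != line (f i3)
      & line (f i2) != line (f i3)] -> (f i2, f i3, f i1) \notin conflicts A pos.
    case=> n12 n13 n23; apply: freeS => //.
    - by apply: contraNneq n23 => ->.
    - by apply: contraNneq n12 => ->.
    - by apply: contraNneq n13 => ->.
  split=> [[/no_conflict/negP nc [[I12 I13 I23] I0]]|[/no_conflict/negP nc [I3 [_ Mv]]]].
    apply: nc; rewrite inE /meeting /closes_triangle /=; apply/andP; split.
      by have [x /setIP[x2 x3]] := set0Pn _ I23; apply/exists_inP; exists x.
    have [x /setIP[x1 x2]] := set0Pn _ I12; have [y /setIP[y1 y3]] := set0Pn _ I13.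
    apply/orP; left; apply/exists_inP; exists x => //; apply/exists_inP; exists y => //.
    apply/and3P; split=> //; apply/eqP => xy.
    by have := in_set0 x; rewrite -I0 !inE x1 x2 xy y3.
  have [x /setIP[/setIP[x1 x2] x3]] := set0Pn _ I3.
  apply: nc; rewrite inE /meeting /closes_tripod /=; apply/andP; split.
    by apply/exists_inP; exists x.
  apply/orP; right; rewrite moving_sample_neq0 //=.
  by apply/exists_inP; exists x => //; rewrite x1 /= -/(line _) Mv subsetUl.
move=> c; have [i iS] := hitS c; rewrite inE => /andP[fi /forall_inP mono].
exists (line (f i)); first by apply: imset_f; rewrite inE iS.
have x1 : subspace_pt (cube_map pos (f i).2.1 (f i).2.2)
            (line_pt (f i).1.1 (f i).1.2 x0) \in line (f i) by apply: imset_f.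
eexists => x xL; apply/eqP; exact: (forall_inP (mono _ xL) _ x1).
Qed.
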